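(* For every $n\ge1$, $$\sum_{\sigma\in S_{NC}^\delta(n,-n)}c^{\#(\sigma)/2}=\sum_{l=1}^{\lfloor n/2\rfloor}\sum_{j=0}^{n-2l}\binom nj\binom n{j+2l}c^{j+l}=\sum_{k=1}^{n-1}a_kc^k,$$ where $$a_k=\sum_{i=1}^{\min\{k,n-k\}}\binom n{k-i}\binom n{k+i}=\frac12\left(\binom{2n}{2k}-\binom nk\binom nk\right).$$
   Context: Here $c>0$ is a parameter (the identities are between polynomials in $c$), and $\#(\sigma)$ is the number of cycles of $\sigma$ (fixed points included). Let $[\pm n]=\{\pm1,\dots,\pm n\}$ and let $S_{\pm n}$ be its symmetric group (products composed right to left). Let $\delta\in S_{\pm n}$, $\delta(k)=-k$; let $\gamma\in S_{\pm n}$ be the cycle $(1,2,\dots,n)$, acting trivially on negative numbers; put $\tilde\gamma=\gamma\delta\gamma^{-1}\delta=(1,2,\dots,n)(-n,\dots,-2,-1)$. A pairing is a permutation all of whose cycles have length 2. $S_{NC}^\delta(n,-n)$ is the set of $\sigma\in S_{\pm n}$ such that (1) the subgroup $\langle\sigma,\tilde\gamma\rangle$ acts transitively on $[\pm n]$; (2) $\#(\sigma)+\#(\sigma^{-1}\tilde\gamma)=2n$; (3) $\sigma\delta$ is a pairing. *)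

(* Defs.v *)
From mathcomp Require Import all_boot all_fingroup.

Set Implicit Arguments.
Unset Strict Implicit.
Unset Printing Implicit Defensive.

Local Open Scope group_scope.

(* The set {1, .., n, -1, .., -n}: inl i stands for i + 1, inr i for -(i + 1). *)
Definition pmset (n : nat) : finType := ('I_n + 'I_n)%type.

Definition neg_fun n (x : pmset n) : pmset n :=
  match x with inl i => inr i | inr i => inl i end.

Lemma neg_fun_inj n : injective (@neg_fun n).
Proof. by case=> i [] j //= [->]. Qed.

Definition delta n : {perm pmset n} := perm (@neg_fun_inj n).

Definition rot_fun n (x : pmset n) : pmset n :=
  match x with inl i => inl (ordS i) | inr i => inr i end.

Lemma rot_fun_inj n : injective (@rot_fun n).
Proof.
case=> i; case=> j //= eq_ij.
congr inl; apply: (can_inj (@ordSK n)).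
by case: eq_ij => eq_ij; apply: val_inj.
Qed.

Definition gamma n : {perm pmset n} := perm (@rot_fun_inj n).

(* Products of permutations act from left to right here, (s * t) x = t (s x),
   so every product below is the reverse of the right-to-left one: this is
   gamma delta gamma^-1 delta in right-to-left notation. *)
Definition gammat n : {perm pmset n} :=
  delta n * (gamma n)^-1 * delta n * gamma n.

Definition ncycles (T : finType) (s : {perm T}) : nat := #|porbits s|.

Definition pairing (T : finType) (s : {perm T}) : bool :=
  [forall C in porbits s, #|C| == 2].

Definition SNCdelta n : {set {perm pmset n}} :=
  [set s | [&& [transitive <<[set s; gammat n]>>, on [set: pmset n] | 'P],
               (ncycles s + ncycles (gammat n * s^-1)%g == 2 * n)%N
             & pairing (delta n * s)]].

Definition acoef (n k : nat) : nat :=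
  (\sum_(1 <= i < (minn k (n - k)).+1) 'C(n, k - i) * 'C(n, k + i))%N.

(* Main.v *)
Require Import Defs.
From mathcomp Require Import all_classical all_reals all_analysis.
From mathcomp Require Import all_boot all_order all_algebra all_fingroup.
From mathcomp Require Import zify.

Set Implicit Arguments.
Unset Strict Implicit.
Unset Printing Implicit Defensive.

Import Order.TTheory GRing.Theory Num.Theory.

Local Open Scope group_scope.
Local Open Scope nat_scope.

(** The points 1, -1, 2, -2, .., n, -n, in this cyclic order, are the vertices
    of a polygon whose 2n edges fall into two alternating classes: the pairs of
    [delta], and the pairs {-k, k + 1} of the pairing [tau = delta * gammat].
    A permutation [s] is recorded by the pairing [p = delta * s].  The cycles
    of [s = delta * p] go around the loops formed by [p] and the edges of the
    first class, each loop being traversed in both directions; up to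
    conjugation, the second factor of condition (2) does the same with
    [tau * p] and the other class.  So condition (2) says that [delta * p] and
    [tau * p] have 2n cycles altogether: gluing the polygon along [p] gives a
    projective plane.

    Both permutations act on the 2n points, so their 2n cycles have average
    length 2.  Either some cycle is a fixed point, which means that [p] joins
    two neighbours of the polygon (a leaf), or every cycle has length exactly
    2, so that [p] commutes with both classes of edges; then [p] is the half
    turn of the polygon and the number of vertices is a multiple of 4
    ([no_leaf_core]).  Removing a leaf yields a shorter polygon that satisfies
    the same count ([turn_leaf_same], [turn_leaf_other]).  Hence [p] is
    obtained from a half turn on 4l points, l > 0, by successively inserting
    leaves ([exists_word]).

    Write the sign + at every point of the half turn, and the signs -, + at the
    two ends of each leaf, in cyclic order.  This is a cyclic word in which +
    exceeds - by 4l.  Conversely such a word reduces to 4l signs + by erasing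
    adjacent factors -+, which tells where the leaves of [p] are
    ([exists_cyclic_matching]).  Neither reduction depends on the order in
    which the leaves are removed: the leaves of [p] and the factors -+ of the
    word are the same at each stage ([leaf_inv]).  So the admissible [s]
    correspond bijectively to the words with excess 4l, l > 0.

    If A is the set of the k > 0 carrying -, and B the set of the k > 0 such
    that -k carries +, the excess is 2 (|B| - |A|), hence |B| = |A| + 2l, and
    counting loops while leaves are removed gives |A| + |B| cycles for [s]
    ([cyclic_matching_count], [word_excess]).  Summing over the pairs (A, B)
    gives the double sum ([sum_SNCdelta]).  Transitivity follows from the rest:
    opposite vertices of a polygon with 4l alternating vertices are both
    positive or both negative numbers.  The remaining two formulas are a
    change of indices and the Vandermonde convolution, whose terms are
    symmetric about the middle one. *)

(** * Permutations, fixed points and involutions *)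

Lemma porbit_fixed (T : finType) (s : {perm T}) x : s x = x -> porbit s x = [set x].
Proof.
move=> sx; apply/setP=> y; rewrite inE; apply/porbitP/eqP => [[i ->]|->].
  by elim: i => [|i IH]; rewrite ?expg0 ?perm1 // expgSr permM IH.
by exists 0; rewrite expg0 perm1.
Qed.

Lemma porbit_pair (T : finType) (s : {perm T}) x : s x != x ->
  [/\ [set x; s x] \subset porbit s x, #|[set x; s x]| = 2
    & (s (s x) == x) = (porbit s x == [set x; s x])].
Proof.
move=> sx; have sub2 : [set x; s x] \subset porbit s x.
  by rewrite subUset !sub1set porbit_id -{1}(expg1 s) mem_porbit.
split=> //; first by rewrite cards2 eq_sym sx.
apply/eqP/eqP => [ssx|E].
  apply/eqP; rewrite eqEsubset sub2 andbT; apply/subsetP => _ /porbitP[i ->].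
  elim: i => [|i]; first by rewrite expg0 perm1 !inE eqxx.
  by rewrite expgSr permM; case/set2P=> ->; rewrite !inE ?ssx eqxx ?orbT.
have /set2P[//|/perm_inj ssx] : s (s x) \in [set x; s x].
  by rewrite -E; have := mem_porbit s 2 x; rewrite expgS expg1 permM.
by rewrite ssx eqxx in sx.
Qed.

(** Every cycle has at least two elements if each fixed point is counted twice;
    equality forces all cycles to have length at most 2. *)
Lemma porbits_leqif_fix (T : finType) (s : {perm T}) :
  2 * #|porbits s| <= #|T| + #|[set x | s x == x]|
    ?= iff [forall x, s (s x) == x].
Proof.
have partT : partition (porbits s) [set: T].
  have acts : [acts <[s]>, on [set: T] | 'P] by apply/actsP => a _ x; rewrite !inE.
  have := orbit_partition acts; congr (partition _ _).
  apply/setP=> C; apply/imsetP/imsetP=> -[x _ ->]; exists x;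
    by rewrite ?inE // porbit.unlock.
have -> : #|T| + #|[set x | s x == x]|
    = \sum_(C in porbits s) \sum_(x in C) (1 + (s x == x)).
  rewrite -(set_partition_big _ partT) big_split /=.
  rewrite sum1_card cardsT; congr (_ + _).
  rewrite -sum1dep_card [LHS]big_mkcond; apply: eq_big => x; rewrite ?inE //.
rewrite mulnC -sum_nat_const.
have -> : [forall x, s (s x) == x]
    = [forall (C | C \in porbits s), [forall (x | x \in C), s (s x) == x]].
  apply/forallP/forall_inP => [inv C _|inv x]; first by apply/forall_inP => x _.
  have xC : porbit s x \in porbits s by apply/imsetP; exists x.
  by have /forall_inP := inv _ xC; apply; apply: porbit_id.
apply: leqif_sum => _ /imsetP[x _ ->].
have [sx_x|sx_x] := eqVneq (s x) x.
  rewrite porbit_fixed // big_set1 sx_x eqxx; split=> //; rewrite eqxx; symmetry.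
  by apply/forall_inP => y /set1P ->; rewrite !sx_x.
have nofix y : y \in porbit s x -> (s y == y) = false.
  move=> /porbitP[i ->]; rewrite -permM -expgSr expgS permM.
  by rewrite (inj_eq perm_inj) (negbTE sx_x).
rewrite (eq_bigr (fun=> 1)) => [|y /nofix -> //]; rewrite sum1_card.
have [sub2 card2 inv2] := porbit_pair sx_x.
rewrite -card2; have := subset_leqif_cards sub2; congr (_ <= _ ?= iff _).
apply/eqP/forall_inP => [E y|inv]; last first.
  by apply/esym/eqP; rewrite -inv2 inv ?porbit_id.
have ssx : s (s x) = x by apply/eqP; rewrite inv2 E.
by rewrite -E; case/set2P=> ->; rewrite ?ssx.
Qed.

(** * Lists without repetition as cyclic orders *)

Section CyclicWords.
Variables (X : finType) (col : X -> bool).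
Implicit Types (L P : seq X) (p : {perm X}) (w : X -> bool) (e : bool).

Lemma traject_next (x : X) (s : seq X) : uniq (x :: s) ->
  x :: s = traject (next (x :: s)) x (size s).+1 /\
  iter (size s).+1 (next (x :: s)) x = x.
Proof.
move=> us; have := cycle_next us; rewrite [path.cycle _ _]/=.
move=> /fpathE; rewrite size_rcons trajectSr => /rcons_inj[E1 E2].
by rewrite trajectS -E1 iterSr -E2.
Qed.

Lemma iter_next_uniq L x : uniq L -> x \in L ->
  [/\ forall y, y \in L -> exists2 k, k < size L & y = iter k (next L) x,
      iter (size L) (next L) x = x
    & {in [pred k | k < size L] &, injective (fun k => iter k (next L) x)}].
Proof.
move=> uL xL; have [i s defL] := rot_to xL.
have us : uniq (x :: s) by rewrite -defL rot_uniq.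
have eqf y k : iter k (next L) y = iter k (next (x :: s)) y.
  by apply: eq_iter => {}y; rewrite -defL next_rot.
have szL : size L = (size s).+1 by rewrite -(size_rot i L) defL.
have [T Tl] := traject_next us; rewrite szL.
split=> [y|//|k l].
- rewrite -(mem_rot i) defL T => /trajectP[k ltk ->]; exists k => //.
  by rewrite eqf.
rewrite !inE !eqf => lk ll E2; apply/eqP.
by rewrite -(nth_uniq x _ _ us) // T !nth_traject // E2.
Qed.

Lemma rot_cons_inj k (x : X) (s t : seq X) :
  uniq (x :: s) -> rot k (x :: s) = x :: t -> s = t.
Proof.
move=> us E; have ut : uniq (x :: t) by rewrite -E rot_uniq.
have [Es _] := traject_next us; have [Et _] := traject_next ut.
have szE : size s = size t by apply/eq_add_S; rewrite -[LHS](size_rot k (x :: s)) E.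
suff: x :: s = x :: t by case.
rewrite Es Et -szE; apply: (@eq_from_nth _ x); rewrite ?size_traject // => i lti.
by rewrite !nth_traject //; apply: eq_iter => y; rewrite -E next_rot.
Qed.

Lemma rot_comp i j (s : seq X) : exists k, rot i (rot j s) = rot k s.
Proof.
have [les|lts] := leqP j (size s); last by rewrite (rot_oversize (ltnW lts)); exists i.
have [les'|lts'] := leqP i (size s).
  by rewrite rot_add_mod //; eexists.
by rewrite rot_oversize ?size_rot 1?ltnW //; exists j.
Qed.

Lemma rot_swap i j (s t : seq X) : rot i s = rot j t -> exists k, t = rot k s.
Proof.
move/(congr1 (rotr j)); rewrite rotK => <-.
by rewrite /rotr; apply: rot_comp.
Qed.

Lemma next_cons2 (x y : X) (s : seq X) : next [:: x, y & s] x = y.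
Proof. by rewrite next_nth !inE eqxx /= eqxx. Qed.

(** * Polygons, matchings and their loops *)

Definition alternating L := {in L, forall x, col (next L x) = ~~ col x}.

Definition matching_on p L :=
  {in L, forall x, [/\ p x \in L, p (p x) = x & p x != x]}.

(** The edge leaving [x] forwards belongs to the class [col x], and the edge
    leaving it backwards to the other class; [nbr e] follows the edge of class
    [e]. *)
Definition nbr e L x := if col x == e then next L x else prev L x.

(** The orbits of [turn e L p] in [L] run along the loops made of the edges of
    class [e] and the pairs of [p].  Vertices outside [L] are left fixed, so
    that polygons with fewer and fewer vertices can be compared within the
    same permutation group. *)
Definition turn e L p x := if x \in L then p (nbr e L x) else x.

(** A permutation is needed to speak of cycles; picking one that agrees with
    [turn] avoids carrying the proofs that [turn] is injective. *)
Definition turn_perm e L p : {perm X} :=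
  odflt 1%g [pick s : {perm X} | [forall x, s x == turn e L p x]].

Lemma mem_nbr e L x : (nbr e L x \in L) = (x \in L).
Proof. by rewrite /nbr; case: ifP; rewrite ?mem_next ?mem_prev. Qed.

Lemma col_prev L x : uniq L -> alternating L -> x \in L ->
  col (prev L x) = ~~ col x.
Proof.
move=> uL altL xL; have := altL (prev L x); rewrite mem_prev => /(_ xL).
by rewrite next_prev // => ->; rewrite negbK.
Qed.

Lemma col_nbr e L x : uniq L -> alternating L -> x \in L ->
  col (nbr e L x) = ~~ col x.
Proof. by move=> uL altL xL; rewrite /nbr; case: ifP; rewrite ?altL ?col_prev. Qed.

Lemma nbrK e L : uniq L -> alternating L -> {in L, cancel (nbr e L) (nbr e L)}.
Proof.
move=> uL altL x xL; rewrite {1}/nbr col_nbr //.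
by rewrite /nbr; case: (col x); case: e; rewrite /= ?prev_next ?next_prev.
Qed.

Lemma turn_permE e L p : uniq L -> alternating L -> matching_on p L ->
  turn_perm e L p =1 turn e L p.
Proof.
move=> uL altL mL.
have inj : injective (turn e L p).
  move=> x y; rewrite /turn; case: ifP => xL; case: ifP => yL.
  - by move/perm_inj/(congr1 (nbr e L)); rewrite !nbrK.
  - have /mL[+ _ _] : nbr e L x \in L by rewrite mem_nbr.
    by move=> + E; rewrite E yL.
  - have /mL[+ _ _] : nbr e L y \in L by rewrite mem_nbr.
    by move=> + E; rewrite -E xL.
  by [].
rewrite /turn_perm; case: pickP => [s /forallP sE x|/(_ (perm inj))/negP[]].
  exact/eqP.
by apply/forallP=> x; rewrite permE.
Qed.

Lemma turn_perm_rot k e L p : uniq L -> turn_perm e (rot k L) p = turn_perm e L p.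
Proof.
move=> uL; rewrite /turn_perm; congr odflt; apply: eq_pick => s /=.
by apply: eq_forallb => x; rewrite /turn /nbr mem_rot next_rot // prev_rot.
Qed.

Lemma alternating_rot k L : uniq L -> alternating L -> alternating (rot k L).
Proof. by move=> uL altL x; rewrite mem_rot next_rot //; apply: altL. Qed.

Lemma matching_rot k p L : matching_on p L -> matching_on p (rot k L).
Proof. by move=> mL x; rewrite !mem_rot; apply: mL. Qed.

Lemma alternating_unrot k L : uniq L -> alternating (rot k L) -> alternating L.
Proof. by move=> uL altL x; have := altL x; rewrite mem_rot next_rot. Qed.

Lemma matching_unrot k p L : matching_on p (rot k L) -> matching_on p L.
Proof. by move=> mL x; have := mL x; rewrite !mem_rot. Qed.

(** * Removing a leaf *)

Section Leaf.
Variables (a b : X) (P : seq X) (p : {perm X}).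
Let L := [:: a, b & P].
Hypotheses (uL : uniq L) (altL : alternating L).

Lemma next_leaf x : x \in P ->
  next L x = if x == last a P then a else next P x.
Proof.
move=> xP; rewrite !next_nth.
have [xa xb] : x != a /\ x != b.
  by move: uL; rewrite /L /= !inE => /and3P[/norP[_ aP] bP _]; split; apply/eqP => E;
    rewrite -?E xP in aP bP.
rewrite {1}/L !inE xP (negbTE xa) (negbTE xb) /=.
rewrite !(eq_sym _ x) (negbTE xa) (negbTE xb).
have uP : uniq P by move: uL => /and3P[].
case: P xP uP => // c M xP uM.
have lt : index x (c :: M) < (size M).+1.
  by rewrite -[(size M).+1]/(size (c :: M)) index_mem.
have -> : (x == last a (c :: M)) = (index x (c :: M) == size M).
  rewrite -(index_last uM); apply/eqP/eqP => [->//|E].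
  by rewrite -(nth_index a xP) E nth_index //; apply: mem_last.
move: (index _ _) lt => i; rewrite [LHS]/=.
case: eqP => [->|/eqP ne] lt; first by rewrite nth_default.
by apply: set_nth_default; rewrite ltn_neqAle ne -ltnS.
Qed.

Lemma prev_leaf x : x \in P ->
  prev L x = if x == head b P then b else prev P x.
Proof.
move=> xP; have uP : uniq P by move: uL => /and3P[].
have bP : b \notin P by move: uL => /and3P[].
have ba : b != a by move: uL; rewrite /L /= !inE => /and3P[/norP[]]; rewrite eq_sym.
apply: (can_inj (prev_next uL)); rewrite next_prev //.
case: ifP => [/eqP E|ne].
  have : x \in P := xP; rewrite {}E.
  rewrite /L; case: P => // c M _.
  by rewrite next_nth !inE eqxx orbT /= eq_sym (negbTE ba) eqxx.
rewrite next_leaf ?mem_prev // next_prev //.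
case: ifP => // /eqP E.
have : next P (prev P x) = x by rewrite next_prev.
rewrite E => E2; move: ne; rewrite -E2.
case: P xP uP => // c M _ uM.
by rewrite next_nth [last _ _]/= mem_last (index_last uM) nth_default // eqxx.
Qed.

Hypotheses (mL : matching_on p L) (pa : p a = b) (pb : p b = a).
Let y := head b P.
Let z := last a P.

Lemma leaf_uniq : [/\ a != b, a \notin P, b \notin P & uniq P].
Proof. by move: uL; rewrite /= !inE negb_or => /and3P[/andP[-> ->] -> ->]. Qed.

Lemma leaf_matching : matching_on p P.
Proof.
have [nab aP bP uP] := leaf_uniq.
move=> x xP; have [] := mL (x := x); first by rewrite !inE xP !orbT.
rewrite !inE => /or3P[/eqP E|/eqP E|-> //] ppx _.
- by move: xP; rewrite -ppx E pa (negbTE bP).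
- by move: xP; rewrite -ppx E pb (negbTE aP).
Qed.

Lemma next_leaf_a : next L a = b.
Proof. exact: next_cons2. Qed.

Lemma prev_leaf_b : prev L b = a.
Proof. by rewrite -next_leaf_a prev_next. Qed.

Lemma col_leaf_b : col b = ~~ col a.
Proof. by rewrite -next_leaf_a altL // !inE eqxx. Qed.

(** A leaf that exhausts the polygon leaves two loops, one too many for a
    projective plane: this is the case excluded in [exists_word]. *)
Lemma turn_digon e : P = [::] -> turn_perm e L p = 1%g.
Proof.
have [nab _ _ _] := leaf_uniq.
move=> P0; apply/permP=> x; rewrite turn_permE // perm1 /turn /L P0.
have pabL : prev [:: a; b] a = b /\ next [:: a; b] b = a.
  by rewrite /= !eqxx ?(eq_sym b) (negbTE nab).
case: ifP => //; rewrite !inE /nbr => /orP[] /eqP->.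
  by move: next_leaf_a; rewrite /L P0 pabL.1 => ->; rewrite if_same.
by move: prev_leaf_b; rewrite /L P0 pabL.2 => ->; rewrite if_same.
Qed.

Hypothesis (P0 : P != [::]).

Let yP : y \in P. Proof. by rewrite /y; case: P P0 => // c M _; rewrite inE eqxx. Qed.
Let zP : z \in P. Proof. by rewrite /z; case: P P0 => // c M _; exact: (mem_last c M). Qed.
Let nz : next L z = a. Proof. by rewrite next_leaf // eqxx. Qed.
Let py : prev L y = b. Proof. by rewrite prev_leaf // eqxx. Qed.
Let pLa : prev L a = z. Proof. by rewrite -nz prev_next. Qed.
Let nb : next L b = y. Proof. by rewrite -py next_prev. Qed.
Let nPz : next P z = y.
Proof.
have [_ _ _] := leaf_uniq; rewrite /z /y; case: P P0 => // c M _ uM.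
by rewrite next_nth [last _ _]/= mem_last (index_last uM) nth_default.
Qed.
Let pPy : prev P y = z.
Proof. by have [_ _ _ uP] := leaf_uniq; rewrite -nPz prev_next. Qed.
Let inL x : x \in P -> x \in L. Proof. by rewrite !inE => ->; rewrite !orbT. Qed.
Let cz : col z = ~~ col a. Proof. by rewrite -nz altL ?negbK // inL. Qed.
Let cy : col y = col a. Proof. by rewrite -nb altL ?col_leaf_b ?negbK // !inE eqxx orbT. Qed.

Lemma leaf_alternating : alternating P.
Proof.
move=> x xP; have := altL (inL xP); rewrite next_leaf //.
by case: eqP => [-> _|//]; rewrite nPz cy cz negbK.
Qed.

Let uP : uniq P. Proof. by case: leaf_uniq. Qed.
Let altP := leaf_alternating.
Let mP := leaf_matching.

(** The edge from [a] to [b] has the class of [a].  Together with the pair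
    {a, b} it forms a loop of its own, whose removal leaves two fixed points,
    as before; the other edges of this class are unchanged. *)
Lemma turn_leaf_same : turn_perm (col a) L p = turn_perm (col a) P p.
Proof.
have [nab aP bP _] := leaf_uniq.
apply/permP=> x; rewrite !turn_permE // /turn !inE.
have [->|xa] := eqVneq x a; first by rewrite (negbTE aP) /nbr eqxx next_leaf_a.
have [->|xb] /= := eqVneq x b.
  by rewrite (negbTE bP) /nbr col_leaf_b prev_leaf_b; case: (col a) pa.
case: ifP => // xP; rewrite /nbr next_leaf // prev_leaf //.
case: (col x =P col a) => cx; case: eqP => // E.
  by move: cx; rewrite E -/z cz; case: (col a).
by case: cx; rewrite E cy.
Qed.

(** In the other class, the edges {z, a} and {b, y} are replaced by {z, y}, so
    [a] and [b] are cut out of the two cycles through them and become two new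
    fixed points. *)
Lemma turn_leaf_other :
  #|porbits (turn_perm (~~ col a) L p)| + 2 = #|porbits (turn_perm (~~ col a) P p)|.
Proof.
have [nab aP bP _] := leaf_uniq.
have nza : z != a by apply: contraNneq aP => <-.
have nzb : z != b by apply: contraNneq bP => <-.
have nya : y != a by apply: contraNneq aP => <-.
have nyb : y != b by apply: contraNneq bP => <-.
have nyz : y != z.
  by apply/eqP => E; have := cy; rewrite E cz; case: (col a).
set s := turn_perm _ P p.
have tD (c d x : X) : x != c -> x != d -> tperm c d x = x.
  by move=> xc xd; rewrite tpermD // eq_sym.
have [naz nbz nyb' nby] : [/\ a != z, b != z, z != y & b != y].
  by split; rewrite eq_sym.
have [nay nba] : a != y /\ b != a by split; rewrite eq_sym.
(* s sends z to p y and y to p z; the transpositions insert b after z and a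
   after y into these cycles *)
have -> : turn_perm (~~ col a) L p = (tperm z b * (tperm a y * s))%g.
  apply/permP=> x; rewrite !permM /s !turn_permE //.
  have [->|xa] := eqVneq x a.
    rewrite (tD z b) // tpermL /turn yP !inE eqxx /=.
    by rewrite /nbr cy pLa pPy; case: (col a).
  have [->|xb] := eqVneq x b.
    rewrite tpermR tD // /turn zP !inE eqxx orbT.
    by rewrite /nbr cz col_leaf_b eqxx nb nPz.
  have [->|xz] := eqVneq x z.
    rewrite tpermL tD // /turn (negbTE bP) inL //.
    by rewrite /nbr cz eqxx nz.
  have [->|xy] := eqVneq x y.
    rewrite (tD z b) // tpermR /turn (negbTE aP) inL //.
    by rewrite /nbr cy py; case: (col a) pb => /=.
  rewrite !tD // /turn !inE (negbTE xa) (negbTE xb) /=.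
  by case: ifP => // xP; rewrite /nbr next_leaf // prev_leaf // (negbTE xz) (negbTE xy).
have fixs c t : t \notin P -> c \in porbit s t -> c = t.
  move=> tP /porbitP[i ->]; elim: i => [|i IH]; first by rewrite expg0 perm1.
  by rewrite expgSr permM IH /s turn_permE // /turn (negbTE tP).
have := porbits_mul_tperm s a y; have := porbits_mul_tperm (tperm a y * s)%g z b.
rewrite /= nzb eq_sym nya.
have -> : a \notin porbit s y.
  by rewrite porbit_sym; apply: contra nya => /(fixs _ _ aP) ->.
have -> : z \notin porbit (tperm a y * s) b.
  apply: contra nzb => /porbitP[i ->]; elim: i => [|i]; first by rewrite expg0 perm1.
  rewrite expgSr => /eqP E; rewrite permM E permM tpermD ?nyb // /s turn_permE //.
  by rewrite /turn (negbTE bP).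
have E u v t : u + 2 = v + 1 -> v + 2 = t + 1 -> u + 2 = t by clear; lia.
exact: E.
Qed.
End Leaf.

(** * Words and matchings *)


(** The pairing [p] on the cyclic list [L] is encoded by the signs [w], [true]
    standing for +.  Everything stays defined on the whole of [X] while [L]
    shrinks, so that no relabelling is involved; the rotation in the second
    constructor lets a leaf straddle the ends of the list. *)
Inductive cyclic_matching w p : seq X -> Prop :=
| CoreMatching L of 0 < size L & 4 %| size L & all w L
    & {in L, forall x, p x = iter (size L)./2 (next L) x} : cyclic_matching w p L
| LeafMatching k a b P of cyclic_matching w p P & w a = false & w b
    & p a = b & p b = a : cyclic_matching w p (rot k [:: a, b & P]).

Lemma cyclic_matching_size w p L : cyclic_matching w p L -> 0 < size L.
Proof. by case=> // k a b P *; rewrite size_rot. Qed.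

Lemma cyclic_matching_rot w p L k : uniq L ->
  cyclic_matching w p L -> cyclic_matching w p (rot k L).
Proof.
move=> uL mL; case: mL uL => {L} [L L0 L4 wL core|j a b P mP wa wb pa pb] uL.
  apply: CoreMatching; rewrite ?size_rot ?(eq_all_r (mem_rot k L)) // => x; rewrite mem_rot => xL.
  by rewrite core //; apply: eq_iter => y; rewrite next_rot.
by have [i ->] := rot_comp k j [:: a, b & P]; apply: LeafMatching.
Qed.

(** Two disjoint pairs of neighbours can be removed in either order, and the
    same cyclic list [M] remains. *)
Lemma two_leaves k a b P c d Q :
    uniq [:: a, b & P] -> [:: c, d & Q] = rot k [:: a, b & P] ->
    c \in P -> d != a ->
  exists M i j l, P = rot i [:: c, d & M] /\ Q = rot j [:: a, b & rot l M].
Proof.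
move=> uL E cP dna; have uP : uniq P by move: uL => /and3P[].
have uc : uniq [:: c, d & Q] by rewrite E rot_uniq.
have next_c : next [:: a, b & P] c = d by rewrite -(next_rot k) // -E next_cons2.
case/splitPr: cP uL E next_c uP => P1 P2 uL E next_c uP.
have E2 : rot (size P1).+2 [:: a, b & P1 ++ c :: P2] = c :: P2 ++ [:: a, b & P1].
  exact: (rot_size_cat [:: a, b & P1]).
have next_c2 : next (c :: P2 ++ [:: a, b & P1]) c = d by rewrite -E2 next_rot.
case: P2 uL E next_c uP E2 next_c2 => [|d' P3] uL E next_c uP E2; rewrite next_cons2.
  by move=> ad; rewrite ad eqxx in dna.
move=> dd; rewrite {}dd in uL E next_c uP E2 *.
have u2 : uniq [:: c, d & P3 ++ [:: a, b & P1]] by rewrite -[_ :: _]E2 rot_uniq.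
have [i E3] : exists i,
    [:: a, b & P1 ++ [:: c, d & P3]] = rot i [:: c, d & P3 ++ [:: a, b & P1]].
  by apply: (@rot_swap 0 (size P1).+2); rewrite rot0 E2.
have [l E4] := rot_comp k i [:: c, d & P3 ++ [:: a, b & P1]].
move: E; rewrite E3 E4 => /esym/(rot_cons_inj u2)[<-].
exists (P3 ++ P1), (size P3).+2, (size P1).+2, (size P3).
rewrite rot_size_cat; split; last exact: (esym (rot_size_cat [:: a, b & P1] P3)).
exact: (esym (rot_size_cat [:: c, d & P3] P1)).
Qed.

(** Confluence: a leaf of [p], or a factor -+ of [w], need not be the last one
    inserted in the derivation of the matching, but derivations can be
    rearranged so that it is.  A half turn on at least 4 points has no leaf,
    and two distinct leaves are disjoint, hence commute by [two_leaves]. *)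
Lemma leaf_inv w p L j c d Q :
    cyclic_matching w p L -> uniq L -> L = rot j [:: c, d & Q] ->
    p c = d \/ (w c = false /\ w d) ->
  [/\ p c = d, p d = c, w c = false, w d & cyclic_matching w p Q].
Proof.
move=> mL; elim: mL j c d Q => {L} [L L0 L4 wL core|k a b P mP IH wa wb pa pb] j c d Q uL E.
  have cL : c \in L by rewrite E mem_rot inE eqxx.
  have nc : next L c = d.
    by rewrite E next_rot ?next_cons2 // -(rot_uniq j) -E.
  case=> [|[]]; last by move/allP: wL => /(_ _ cL) ->.
  rewrite core // -nc => E2.
  have [_ _ inj] := iter_next_uniq uL cL.
  have : (size L)./2 = 1 by apply: inj => //; rewrite inE; lia.
  lia.
rewrite rot_uniq in uL.
have [uP [nab [aP bP]]] : uniq P /\ a != b /\ a \notin P /\ b \notin P.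
  by move: uL => /= /and3P[]; rewrite inE negb_or => /andP[-> ->] -> ->.
have [i Ei] := rot_swap (esym E).
have [i' Ei'] := rot_swap E.
have ucd : uniq [:: c, d & Q] by rewrite Ei' rot_uniq.
have nL x : next [:: a, b & P] x = next [:: c, d & Q] x by rewrite Ei next_rot.
have nab' : next [:: a, b & P] a = b by apply: next_cons2.
have ncd : next [:: a, b & P] c = d by rewrite nL next_cons2.
have [ca|nca] := eqVneq c a.
  have db : d = b by rewrite -ncd ca.
  move=> _; rewrite ca db in Ei' *.
  by move/esym: Ei' => /(rot_cons_inj uL)[<-].
have ndb : d != b by apply: contra nca => /eqP E2; rewrite -(can_eq (prev_next uL)) ncd nab' E2.
have [cb|ncb] := eqVneq c b.
  case=> [|[]]; last by rewrite cb wb.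
  rewrite cb pb => da; move: mP; rewrite (_ : P = [::]) => [/cyclic_matching_size//|].
  move: ncd; rewrite cb -da next_nth !inE eqxx orbT /= (negbTE nab) eqxx.
  by case: (P) aP => // x P'; rewrite inE => /norP[+ _] /= xa; rewrite xa eqxx.
have [da|nda] := eqVneq d a.
  by case=> [|[_]]; rewrite da ?wa // -pb => /perm_inj cb; rewrite cb eqxx in ncb.
have cP : c \in P.
  have : c \in rot i' [:: a, b & P] by rewrite -Ei' inE eqxx.
  by rewrite mem_rot !inE (negbTE nca) (negbTE ncb).
have [M [i1 [j1 [l [E1 E2]]]]] := two_leaves uL Ei' cP nda.
move=> /(IH _ _ _ _ uP E1)[pc pd wc wd mM]; split=> //; rewrite E2.
apply: LeafMatching => //; apply: cyclic_matching_rot => //.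
by move: uP; rewrite E1 rot_uniq => /and3P[].
Qed.



Lemma cyclic_matching_inj_perm w p p' L : uniq L ->
  cyclic_matching w p L -> cyclic_matching w p' L -> {in L, p =1 p'}.
Proof.
move=> uL m; elim: m uL => {L} [L L0 L4 wL core|k a b P mP IH wa wb pa pb] uL m'.
  case: m' L0 wL core {L4 uL} => {L} [L _ _ _ core'|k a b P _ wa _ _ _] _ wL core x xL.
    by rewrite core // core'.
  by move/allP: wL => /(_ a); rewrite wa mem_rot inE eqxx => /(_ isT).
have [|pa' pb' _ _ mP'] := leaf_inv m' uL (erefl _); first by right.
move: (uL); rewrite rot_uniq => /leaf_uniq[_ _ _ uP].
move=> x; rewrite mem_rot !inE => /or3P[/eqP->|/eqP->|]; rewrite ?pa ?pb //.
exact: IH.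
Qed.

Lemma cyclic_matching_inj_word w w' p L : uniq L ->
  cyclic_matching w p L -> cyclic_matching w' p L -> {in L, w =1 w'}.
Proof.
move=> uL m; elim: m uL => {L} [L L0 L4 wL core|k a b P mP IH wa wb pa pb] uL m'.
  have m : cyclic_matching w p L by apply: CoreMatching.
  case: m' m uL wL {L4 L0 core} => {L} [L _ _ w'L _|k a b P _ wa wb pa pb] m uL wL x xL.
    by rewrite (allP wL) // (allP w'L).
  have [|_ _ wa' _ _] := leaf_inv m uL (erefl _); first by left.
  by move/allP: wL => /(_ a); rewrite wa' mem_rot inE eqxx => /(_ isT).
have [|_ _ wa' wb' mP'] := leaf_inv m' uL (erefl _); first by left.
move: (uL); rewrite rot_uniq => /leaf_uniq[_ _ _ uP].
move=> x; rewrite mem_rot !inE => /or3P[/eqP->|/eqP->|].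
- by rewrite wa wa'.
- by rewrite wb wb'.
exact: IH.
Qed.

Lemma mem_iter_next L k x : (iter k (next L) x \in L) = (x \in L).
Proof. by elim: k => //= k IH; rewrite mem_next. Qed.

Lemma iter_next_matching L p : uniq L -> 0 < size L -> ~~ odd (size L) ->
  {in L, forall x, p x = iter (size L)./2 (next L) x} -> matching_on p L.
Proof.
move=> uL L0 L2 core x xL; have [_ E inj] := iter_next_uniq uL xL.
rewrite (core x) // mem_iter_next xL core ?mem_iter_next // -iterD.
rewrite -[X in iter X]/((size L)./2 + (size L)./2) addnn even_halfK // E; split=> //.
apply/eqP => E2; have : (size L)./2 = 0 by apply: inj => //; rewrite inE; lia.
lia.
Qed.

Lemma cyclic_matchingP w p L : uniq L -> cyclic_matching w p L -> matching_on p L.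
Proof.
move=> uL m; elim: m uL => {L} [L L0 L4 wL core|k a b P mP IH wa wb pa pb] uL.
  by apply: iter_next_matching => //; lia.
apply: matching_rot; move: (uL); rewrite rot_uniq => /leaf_uniq[nab aP bP uP].
move=> x; rewrite !inE => /or3P[/eqP->|/eqP->|xP].
- by rewrite pa pb eqxx orbT eq_sym.
- by rewrite pb pa eqxx.
by have [-> -> ->] := IH uP x xP; rewrite !orbT.
Qed.

Lemma eq_cyclic_matching w w' p p' L : {in L, w =1 w'} -> {in L, p =1 p'} ->
  cyclic_matching w p L -> cyclic_matching w' p' L.
Proof.
move=> ew ep m; elim: m ew ep => {L} [L L0 L4 wL core|k a b P mP IH wa wb pa pb] ew ep.
  apply: CoreMatching => // [|x xL]; last by rewrite -ep ?core.
  by apply/allP => x xL; rewrite -ew // (allP wL).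
have [aL bL] : a \in rot k [:: a, b & P] /\ b \in rot k [:: a, b & P].
  by rewrite !mem_rot !inE !eqxx orbT.
apply: LeafMatching; rewrite -?ew -?ep //.
by apply: IH => x xP; [apply: ew|apply: ep]; rewrite mem_rot !inE xP !orbT.
Qed.

(** The half turn moves by an even number of steps. *)
Lemma core_col L p : alternating L -> ~~ odd (size L)./2 ->
  {in L, forall x, p x = iter (size L)./2 (next L) x} ->
  {in L, forall x, col (p x) = col x}.
Proof.
move=> altL + core x xL; rewrite core //; move: (_./2) => h /negbTE oh.
suff -> : col (iter h (next L) x) = col x (+) odd h by rewrite oh addbF.
elim: h {oh} => [|h IH]; first by rewrite addbF.
by rewrite iterS altL ?mem_iter_next // IH oddS -addbN.
Qed.

(** The half turn commutes with both classes of edges, so [turn_perm] is an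
    involution; it has no fixed point in [L] because the half turn preserves
    colours whereas edges change them. *)
Lemma core_porbits L p e : uniq L -> alternating L ->
    0 < size L -> 4 %| size L ->
    {in L, forall x, p x = iter (size L)./2 (next L) x} ->
  #|porbits (turn_perm e L p)| + (size L)./2 = #|X|.
Proof.
move=> uL altL L0 L4 core.
have mL : matching_on p L by apply: iter_next_matching => //; lia.
have pcol : {in L, forall x, col (p x) = col x} by apply: core_col => //; lia.
have pnext : {in L, forall x, p (next L x) = next L (p x)}.
  by move=> x xL; rewrite !core ?mem_next // -iterS -iterSr.
have pnbr : {in L, forall x, p (nbr e L x) = nbr e L (p x)}.
  move=> x xL; have [pxL _ _] := mL x xL; rewrite /nbr pcol //; case: ifP => _.
    exact: pnext.
  apply: (can_inj (prev_next uL)); rewrite next_prev //.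
  by rewrite -pnext ?mem_prev // next_prev.
have [_ /esym] := porbits_leqif_fix (turn_perm e L p).
have -> : [forall x, turn_perm e L p (turn_perm e L p x) == x].
  apply/forallP => x; rewrite !turn_permE // {2}/turn; case: ifP => xL; last first.
    by rewrite /turn xL.
  have nL : nbr e L x \in L by rewrite mem_nbr.
  have [pnL ppn _] := mL _ nL.
  by rewrite /turn pnL -pnbr // nbrK ?ppn //; apply/eqP; have [_ ->] := mL x xL.
have -> : [set x | turn_perm e L p x == x] = ~: [set x in L].
  apply/setP => x; rewrite !inE turn_permE // /turn; case: ifP => xL; last by rewrite eqxx.
  have nL : nbr e L x \in L by rewrite mem_nbr.
  apply/eqP => E; have := pcol _ nL; rewrite E col_nbr //.
  by case: (col x).
rewrite (cardsCs (~: _)) setCK cardsE (card_uniqP uL).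
have := max_card [in L]; rewrite (card_uniqP uL).
by move=> le /esym/eqP; lia.
Qed.

(** In the class [e], the half turn on 4l points merges its vertices into 2l
    cycles, and each leaf of the other class merges two further pairs of
    cycles, while a leaf of class [e] changes nothing.  The class of a leaf is
    the colour of its end carrying -. *)
Lemma cyclic_matching_count w p L :
    cyclic_matching w p L -> uniq L -> alternating L ->
  exists l, [/\ 0 < l, size L = 4 * l + 2 * count (predC w) L
    & forall e, #|porbits (turn_perm e L p)| + 2 * l
        + 2 * count [pred x | ~~ w x && (col x != e)] L = #|X|].
Proof.
elim=> {L} [L L0 L4 wL core|k a b P mP IH wa wb pa pb] uL altL.
  have no_neg : count (predC w) L = 0.
    by apply/eqP; rewrite -leqn0 leqNgt -has_count has_predC wL.
  exists (size L %/ 4); split=> [||e]; [lia|by rewrite no_neg; lia|].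
  have -> : count [pred x | ~~ w x && (col x != e)] L = 0.
    apply/eqP; rewrite -leqn0 -no_neg; apply: sub_count => x /=.
    by case: (w x).
  by rewrite -(core_porbits e uL altL L0 L4 core); lia.
have mL : matching_on p (rot k [:: a, b & P]).
  by apply: (@cyclic_matchingP w) => //; apply: LeafMatching.
have P0 : P != [::] by have := cyclic_matching_size mP; case: (P).
move/matching_unrot: mL => mL.
rewrite rot_uniq in uL; have [_ _ _ uP] := leaf_uniq uL.
 move/(alternating_unrot uL): altL => altL.
have [l [l0 szP E]] := IH uP
  (leaf_alternating uL altL P0).
have cnt q : count q (rot k [:: a, b & P]) = q a + (q b + count q P).
  by rewrite -[RHS]/(count q [:: a, b & P]); apply/seq.permP; rewrite perm_rot.
exists l; split=> // [|e]; first by rewrite size_rot cnt /= wa wb szP; lia.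
rewrite turn_perm_rot // cnt /= wa wb /= -(E e).
have [->|ne] := eqVneq e (col a).
  by rewrite (turn_leaf_same uL altL mL pa pb P0).
have -> : e = ~~ col a by move: ne; case: (e); case: (col a).
rewrite -(turn_leaf_other uL altL mL pa pb P0).
by case: (col a) => /=; lia.
Qed.

(** Any point of the half turn is a witness.  For the polygon on the k and -k
    it yields a cycle of [s] that meets both the k > 0 and the k < 0. *)
Lemma cyclic_matching_same_color w p L :
    cyclic_matching w p L -> uniq L -> alternating L ->
  exists2 x, x \in L & col (p x) = col x.
Proof.
elim=> {L} [L L0 L4 wL core|k a b P mP IH wa wb pa pb] uL altL.
  case: L L0 L4 core uL altL {wL} => // x s _ L4 core uL altL.
  exists x; first by rewrite inE eqxx.
  by apply: (core_col altL) => //; rewrite ?inE ?eqxx //; lia.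
have P0 : P != [::] by have := cyclic_matching_size mP; case: (P).
rewrite rot_uniq in uL; have [_ _ _ uP] := leaf_uniq uL.
 move/(alternating_unrot uL): altL => altL.
have [x xP cx] := IH uP
  (leaf_alternating uL altL P0).
by exists x => //; rewrite mem_rot !inE xP !orbT.
Qed.



(** * Existence of the matching and of the word *)

(** Start from a position carrying - and walk to the first + after it. *)
Lemma cyclic_ascent w L : has (predC w) L -> has w L ->
  exists k a b P, [/\ L = rot k [:: a, b & P], w a = false & w b].
Proof.
move=> /hasP[x xL nwx] hL; have [i s defL] := rot_to xL.
have hs : has w s.
  move: hL; rewrite -(has_rot i) defL /=.
  by move: nwx => /= /negbTE ->.
have [s1 [a [b [s2 [E wa wb]]]]] : exists s1 a b s2,
    [/\ x :: s = s1 ++ [:: a, b & s2], w a = false & w b].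
  elim: s x nwx hs {xL defL} => // y s IH x /= /negbTE nwx.
  have [wy _|nwy /= hs] := boolP (w y); first by exists [::], x, y, s.
  by have [s1 [a [b [s2 [-> wa wb]]]]] := IH y nwy hs; exists (x :: s1), a, b, s2.
have [k Ek] : exists k, L = rot k [:: a, b & s2 ++ s1].
  apply: (@rot_swap (size [:: a, b & s2] + 0) i).
  by rewrite defL E addn0 -cat_cons -cat_cons rot_size_cat.
by exists k, a, b, (s2 ++ s1).
Qed.

(** Erasing a factor -+ preserves the excess of + over -.  As the excess is
    positive, the process can only stop at a word without -. *)
Lemma exists_cyclic_matching w L : uniq L ->
    4 %| size L - 2 * count (predC w) L -> 2 * count (predC w) L < size L ->
  exists2 p, perm_on [set x in L] p & cyclic_matching w p L.
Proof.
have [n] := ubnP (size L); elim: n L => // n IH L ltLn uL L4 ltL.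
have [wL|] := boolP (all w L).
  have c0 : count (predC w) L = 0.
    by apply/eqP; rewrite -leqn0 leqNgt -has_count has_predC wL.
  rewrite {}c0 in L4 ltL; set s := perm (can_inj (prev_next uL)).
  have sE k x : (s ^+ k)%g x = iter k (next L) x.
    by rewrite permX; apply: eq_iter => y; rewrite permE.
  exists (s ^+ (size L)./2)%g; last by apply: CoreMatching => //; lia.
  apply/subsetP => x; rewrite !inE sE; apply: contraNT => xL.
  apply/eqP; elim: (_./2) => //= k ->; rewrite next_nth (negbTE xL) //.
rewrite -has_predC => nwL; have wL : has w L.
  by rewrite has_count; have := count_predC w L; lia.
have [k [a [b [P [E wa wb]]]]] := cyclic_ascent nwL wL.
have cnt q : count q L = q a + (q b + count q P).
  by rewrite E -[RHS]/(count q [:: a, b & P]); apply/seq.permP; rewrite perm_rot.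
have szL : size L = (size P).+2 by rewrite E size_rot.
have uL' := uL; rewrite E in uL'; move: (uL'); rewrite rot_uniq => /leaf_uniq[nab aP bP uP].
rewrite {}cnt /= wa wb szL in L4 ltL ltLn.
have [|||p pP mP] := IH P _ uP; [lia|by apply: etrans L4; congr (_ %| _); lia|lia|].
exists (tperm a b * p)%g.
  apply/subsetP => x; rewrite !inE permM E mem_rot !inE.
  have [->|xa] //= := eqVneq x a; have [->|xb] //= := eqVneq x b.
  apply: contraNT => xP; rewrite tpermD 1?eq_sym // (out_perm pP) ?inE //.
rewrite E; apply: LeafMatching => //.
- apply: eq_cyclic_matching mP => // x xP; rewrite permM tpermD //.
    by apply: contraNneq aP => ->.
  by apply: contraNneq bP => ->.
- by rewrite permM tpermL (out_perm pP) // inE.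
- by rewrite permM tpermR (out_perm pP) // inE.
Qed.

(** Without leaves, [turn_perm] has no fixed point in [L] for either class, so
    the bound of [porbits_leqif_fix] is attained and [p] commutes with both
    classes of edges.  Thus [p] is determined by the image of one vertex: it
    is a rotation if it preserves colours there, and otherwise a reflection
    through the middle of an edge, which would join the ends of that edge. *)
Lemma no_leaf_core L p : uniq L -> alternating L -> matching_on p L ->
    0 < size L -> {in L, forall x, p x != next L x} ->
    #|porbits (turn_perm true L p)| + #|porbits (turn_perm false L p)| + size L
      = 2 * #|X| ->
  4 %| size L /\ {in L, forall x, p x = iter (size L)./2 (next L) x}.
Proof.
move=> uL altL mL L0 noleaf total.
have fixE e : [set x | turn_perm e L p x == x] = ~: [set x in L].
  apply/setP => x; rewrite !inE turn_permE // /turn; case: ifP => xL; last by rewrite eqxx.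
  apply/eqP => E; have [pxL ppx nx] := mL x xL.
  have nxL : nbr e L x \in L by rewrite mem_nbr.
  have px : p x = nbr e L x by rewrite -{1}E; have [_ ->] := mL _ nxL.
  move: px; rewrite /nbr; case: ifP => _ px.
    by have := noleaf x xL; rewrite px eqxx.
  by have := noleaf _ pxL; rewrite ppx px next_prev // eqxx.
have fixN : #|~: [set x in L]| + size L = #|X|.
  by rewrite (cardsCs (~: _)) setCK cardsE (card_uniqP uL) subnK // -(card_uniqP uL) max_card.
have inv e x : turn_perm e L p (turn_perm e L p x) = x.
  have [le1 eq1] := porbits_leqif_fix (turn_perm true L p).
  have [le2 eq2] := porbits_leqif_fix (turn_perm false L p).
  have [/esym/forallP invt /esym/forallP invf] :
      true = [forall x, turn_perm true L p (turn_perm true L p x) == x] /\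
      true = [forall x, turn_perm false L p (turn_perm false L p x) == x].
    rewrite -eq1 -eq2; move: le1 le2; rewrite !fixE; lia.
  by apply/eqP; case: e.
have pnbr e : {in L, forall x, p (nbr e L x) = nbr e L (p x)}.
  move=> x xL; have nL : nbr e L x \in L by rewrite mem_nbr.
  have [pxL _ _] := mL x xL; have [_ ppn _] := mL _ nL.
  have npL : nbr e L (p x) \in L by rewrite mem_nbr.
  have := inv e (nbr e L x); rewrite !turn_permE // {2}/turn nL nbrK //.
  by rewrite /turn pxL => <-; have [_ ->] := mL _ npL.
case: L L0 uL altL mL noleaf total {fixE inv} pnbr fixN => // x0 s _.
set L := x0 :: s => uL altL mL noleaf _ pnbr _.
have x0L : x0 \in L by rewrite inE eqxx.
have [onto itx inj] := iter_next_uniq uL x0L; have [px0L ppx0 nx0] := mL _ x0L.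
have iL i y : (iter i (next L) y \in L) = (y \in L) by apply: mem_iter_next.
have coli i : col (iter i (next L) x0) = col x0 (+) odd i.
  elim: i => [|i IH]; first by rewrite addbF.
  by rewrite iterS altL ?iL // IH /= addbN.
have [k ltk px0] := onto _ px0L.
have [/eqP cpx|ncpx] := boolP (col (p x0) == col x0); last first.
  (* the reflection: walking forwards from x0 means walking backwards from its
     image, and the two walks become adjacent after half of the k steps *)
  have odd_k : odd k.
    by move: ncpx; rewrite px0 coli; case: (col x0); case: (odd k).
  have refl i : p (iter i (next L) x0) = iter i (prev L) (p x0) /\
      col (p (iter i (next L) x0)) = ~~ col (iter i (next L) x0).
    elim: i => [|i [IH1 IH2]]; first by move: ncpx => /=; case: (col x0); case: (col (p x0)).
    set y := iter i (next L) x0 in IH1 IH2 *; rewrite !iterS -/y -IH1.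
    have yL : y \in L by rewrite iL.
    have [pyL _ _] := mL _ yL.
    have := pnbr (col y) y yL; rewrite /nbr eqxx IH2 => ->.
    have -> : (~~ col y == col y) = false by case: (col y).
    by rewrite col_prev // IH2 altL.
  have [E _] := refl k./2.
  have := noleaf (iter k./2 (next L) x0); rewrite iL => /(_ x0L)/eqP[].
  have iterK i y : iter i (prev L) (iter i (next L) y) = y.
    by elim: i y => // i IH y; rewrite iterSr iterS prev_next // IH.
  rewrite E px0 -[RHS](iterK k./2) -iterS -iterD; congr (iter _ _ (iter _ _ _)).
  lia.
(* the rotation: p moves every vertex k steps forwards, and k steps done twice
   must close up *)
have tr i : p (iter i (next L) x0) = iter i (next L) (p x0) /\
    col (p (iter i (next L) x0)) = col (iter i (next L) x0).
  elim: i => [|i [IH1 IH2]]; first by [].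
  set y := iter i (next L) x0 in IH1 IH2 *; rewrite !iterS -/y -IH1.
  have yL : y \in L by rewrite iL.
  have [pyL _ _] := mL _ yL.
  have := pnbr (col y) y yL; rewrite /nbr eqxx IH2 eqxx => ->.
  by rewrite !altL // IH2.
have k0 : 0 < k by rewrite lt0n; apply: contraNneq nx0 => k0; rewrite px0 k0.
have ek : ~~ odd k by move: cpx; rewrite px0 coli; case: (col x0); case: (odd k).
have kk : iter (k + k) (next L) x0 = x0.
  by rewrite iterD -px0 -(tr k).1 -px0.
have k2 : k + k = size L.
  have [lt|] := ltnP (k + k) (size L).
    have : k + k = 0 by apply: inj => //; rewrite inE; lia.
    lia.
  rewrite leq_eqVlt => /predU1P[//|gt].
  have : k + k - size L = 0.
    apply: inj; rewrite ?inE; [lia|lia|].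
    by rewrite -{1}itx -iterD subnK ?kk //; lia.
  lia.
split; first lia.
move=> x /onto[i _ ->]; rewrite (tr i).1 px0 -!iterD addnC; congr iter; lia.
Qed.

(** Induction on the length: peel leaves until the half turn remains. *)
Lemma exists_word p L : uniq L -> alternating L -> matching_on p L ->
    0 < size L ->
    #|porbits (turn_perm true L p)| + #|porbits (turn_perm false L p)| + size L
      = 2 * #|X| ->
  exists w, cyclic_matching w p L.
Proof.
have [n] := ubnP (size L); elim: n L => // n IH L ltLn uL altL mL L0 total.
have [/allP noleaf|] := boolP (all (fun x => p x != next L x) L).
  have [L4 core] := no_leaf_core uL altL mL L0 noleaf total.
  by exists xpredT; apply: CoreMatching => //; apply: all_predT.
rewrite -has_predC => /hasP[a aL /negPn/eqP pa].
have [k s defL] := rot_to aL; have [_ ppa npa] := mL a aL.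
case: s defL => [|b P] defL.
  by move: npa; rewrite pa -(next_rot k) // defL /= eqxx /= eqxx.
have nab : next L a = b by rewrite -(next_rot k) // defL next_cons2.
have pb : p b = a by rewrite -nab -pa.
rewrite nab in pa.
have uL' : uniq [:: a, b & P] by rewrite -defL rot_uniq.
have altL' : alternating [:: a, b & P] by rewrite -defL; apply: alternating_rot.
have mL' : matching_on p [:: a, b & P] by rewrite -defL; apply: matching_rot.
have szL : size L = (size P).+2 by rewrite -(size_rot k) defL.
have total' : #|porbits (turn_perm true [:: a, b & P] p)|
    + #|porbits (turn_perm false [:: a, b & P] p)| + (size P).+2 = 2 * #|X|.
  by rewrite -defL !turn_perm_rot // -szL.
have [P0|P0] := eqVneq P [::].
  have porbits1 : #|porbits (1%g : {perm X})| = #|X|.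
    have [_ /esym] := porbits_leqif_fix (1%g : {perm X}).
    have -> : [set x | (1%g : {perm X}) x == x] = setT.
      by apply/setP => x; rewrite !inE perm1 eqxx.
    have -> : [forall x, (1%g : {perm X}) ((1%g : {perm X}) x) == x].
      by apply/forallP => x; rewrite !perm1.
    by rewrite cardsT => /esym/eqP; lia.
  move: total'; rewrite !(turn_digon uL' altL' mL' pa pb) // porbits1 P0 /=.
  by move: #|X| => N; clear; lia.
have [nab' aP bP uP] := leaf_uniq uL'.
have ltP : size P < n by rewrite szL in ltLn; lia.
have [||w mw] := IH P ltP uP (leaf_alternating uL' altL' P0) (leaf_matching uL' mL' pa pb).
- by case: (P) P0.
- have := turn_leaf_same uL' altL' mL' pa pb P0.
  have := turn_leaf_other uL' altL' mL' pa pb P0.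
  have sum u v u' v' t N : u + 2 = u' -> v = v' ->
      (u + v + t.+2 = N -> u' + v' + t = N) /\ (v + u + t.+2 = N -> v' + u' + t = N).
    by clear; lia.
  case: (col a) => E1 /(congr1 (fun s => #|porbits s|)) E2.
    exact: (sum _ _ _ _ _ _ E1 E2).2 total'.
  exact: (sum _ _ _ _ _ _ E1 E2).1 total'.
pose w' x := if x == a then false else if x == b then true else w x.
exists w'; have := @cyclic_matching_rot w' p (rot k L) (size L - k).
rewrite -[size L - k](congr1 (subn^~ k) (size_rot k L)) -/(rotr k _) rotK rot_uniq.
apply=> //; rewrite defL -(rot0 [:: _, _ & _]); apply: LeafMatching => //.
- apply: eq_cyclic_matching mw => // x xP; rewrite /w'.
  have [xa|_] := eqVneq x a; first by rewrite -xa xP in aP.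
  by have [xb|//] := eqVneq x b; rewrite -xb xP in bP.
- by rewrite /w' eqxx.
by rewrite /w' eqxx eq_sym (negbTE nab').
Qed.


End CyclicWords.

(** * The polygon of the elements k and -k *)

Lemma card_porbits_conj (T : finType) (s t : {perm T}) :
  #|porbits (s ^ t)| = #|porbits s|.
Proof.
have img x : porbit (s ^ t) (t x) = t @: porbit s x.
  apply/setP => y; apply/porbitP/idP => [[i ->]|/imsetP[_ /porbitP[i ->] ->]].
    by rewrite -conjXg permJ imset_f ?mem_porbit.
  by exists i; rewrite -conjXg permJ.
rewrite -[RHS](card_imset _ (imset_inj (@perm_inj _ t))); congr #|pred_of_set _|.
apply/setP => C; apply/imsetP/imsetP => [[x _ ->]|[_ /imsetP[x _ ->] ->]].
  by exists (porbit s (t^-1 x)); rewrite ?imset_f // -img permKV.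
by exists (t x); rewrite ?img.
Qed.

Lemma pairingP (T : finType) (s : {perm T}) :
  reflect (forall x, s (s x) = x /\ s x != x) (pairing s).
Proof.
apply: (iffP forall_inP) => [pair x|inv C /imsetP[x _ ->]]; last first.
  have [ssx sx] := inv x; have [_ c2 E] := porbit_pair sx.
  by rewrite ssx eqxx in E; rewrite (eqP (esym E)) c2.
have /eqP card2 : #|porbit s x| == 2 by apply: pair; apply/imsetP; exists x.
have [sx|sx] := eqVneq (s x) x.
  by rewrite porbit_fixed // cards1 in card2.
split=> //; have [sub c2 E] := porbit_pair sx; apply/eqP; rewrite E eq_sym.
by rewrite -(subset_leqif_cards sub).2 c2 card2.
Qed.

Section Annulus.
Variable m : nat.
Local Notation n := m.+1.

Definition is_pos (x : pmset n) := if x is inl _ then true else false.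

Definition polygon_step (x : pmset n) : pmset n :=
  match x with inl i => inr i | inr i => inl (ordS i) end.

Lemma polygon_step_inj : injective polygon_step.
Proof.
case=> i [] j //= [] => [->//|E]; rewrite -(ordSK i) -(ordSK j).
by congr (inr (ord_pred _)); apply: val_inj.
Qed.

(** The list 1, -1, 2, -2, .., n, -n. *)
Definition polygon : seq (pmset n) := fingraph.orbit polygon_step (inl ord0).

Lemma polygon_uniq : uniq polygon. Proof. exact: orbit_uniq. Qed.

Lemma mem_polygon x : x \in polygon.
Proof.
have pos k (ltk : k < n) : fconnect polygon_step (inl ord0) (inl (Ordinal ltk)).
  elim: k ltk => [|k IH] ltk; first by rewrite (_ : Ordinal ltk = ord0) //; apply: val_inj.
  apply: connect_trans (IH (ltnW ltk)) _.
  have := fconnect_iter polygon_step 2 (inl (Ordinal (ltnW ltk))); congr (fconnect _ _ (inl _)).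
  by apply: val_inj; rewrite /= modn_small.
rewrite -fconnect_orbit; case: x => -[i lti]; first exact: pos.
by apply: connect_trans (pos i lti) _; apply: (fconnect_iter polygon_step 1).
Qed.

Lemma size_polygon : size polygon = 2 * n.
Proof.
rewrite -(card_uniqP polygon_uniq) (eq_card mem_polygon).
by rewrite card_sum card_ord mul2n addnn.
Qed.

Lemma next_polygon : next polygon =1 polygon_step.
Proof.
move=> x; apply/esym/eqP.
exact: (next_cycle (cycle_orbit polygon_step_inj _) (mem_polygon x)).
Qed.

Lemma prev_polygon x : prev polygon (polygon_step x) = x.
Proof. by rewrite -next_polygon prev_next ?polygon_uniq. Qed.

Lemma polygon_alternating : alternating is_pos polygon.
Proof. by move=> x _; rewrite next_polygon; case: x. Qed.

(** The edges {-k, k + 1} of the polygon. *)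
Definition tau : {perm pmset n} := (delta n * gammat n)%g.

Lemma deltaK : (delta n * delta n = 1)%g.
Proof. by apply/permP => x; rewrite permM !permE; case: x. Qed.

Lemma tauE : tau = ((gamma n)^-1 * delta n * gamma n)%g.
Proof. by rewrite /tau /gammat !mulgA deltaK mul1g. Qed.

Lemma nbr_pos x : nbr is_pos true polygon x = delta n x.
Proof.
rewrite /nbr permE; case: x => i /=; first by rewrite next_polygon.
exact: (prev_polygon (inl i)).
Qed.

Lemma nbr_neg x : nbr is_pos false polygon x = tau x.
Proof.
rewrite /nbr tauE !permM; case: x => i /=; last first.
  have -> : (gamma n)^-1%g (inr i) = inr i by apply: (canLR (permK _)); rewrite permE.
  by rewrite !permE /= next_polygon.
have -> : (gamma n)^-1%g (inl i) = inl (ord_pred i).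
  by apply: (canLR (permK _)); rewrite permE /= ord_predK.
by rewrite !permE /= -[inl i]/(inl i : pmset n) -{1}(ord_predK i) (prev_polygon (inr _)).
Qed.

Section Matching.
Variable p : {perm pmset n}.

Lemma pairing_matching : reflect (matching_on p polygon) (pairing p).
Proof.
apply: (iffP (pairingP p)) => [inv x _|mp x].
  by have [-> ->] := inv x; rewrite mem_polygon.
by have [_ -> ->] := mp x (mem_polygon x).
Qed.

Hypothesis mp : matching_on p polygon.

Lemma turn_pos : turn_perm is_pos true polygon p = (delta n * p)%g.
Proof.
apply/permP => x; rewrite turn_permE ?polygon_uniq //; last exact: polygon_alternating.
by rewrite /turn mem_polygon nbr_pos permM.
Qed.

Lemma turn_neg : turn_perm is_pos false polygon p = (tau * p)%g.
Proof.
apply/permP => x; rewrite turn_permE ?polygon_uniq //; last exact: polygon_alternating.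
by rewrite /turn mem_polygon nbr_neg permM.
Qed.

Lemma ncycles_pos : ncycles (delta n * p)%g = #|porbits (turn_perm is_pos true polygon p)|.
Proof. by rewrite turn_pos. Qed.

(** Conjugating by [delta] turns [gammat * s^-1] into [tau * p]. *)
Lemma ncycles_neg :
  ncycles (gammat n * (delta n * p)^-1)%g
    = #|porbits (turn_perm is_pos false polygon p)|.
Proof.
have pV : (p^-1 = p)%g.
  apply/permP => x; apply: (canLR (permK _)).
  by have [_ -> _] := mp (mem_polygon x).
have dV : ((delta n)^-1 = delta n)%g by apply/eqP; rewrite eq_invg_mul deltaK.
rewrite turn_neg /ncycles -(card_porbits_conj (tau * p)%g (delta n)).
by rewrite conjgE dV /tau invMg pV dV !mulgA deltaK mul1g.
Qed.

End Matching.

Lemma SNCdelta_word s : s \in SNCdelta n ->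
  exists w, cyclic_matching w (delta n * s)%g polygon.
Proof.
rewrite inE => /and3P[_ /eqP total /pairing_matching mp].
apply: (exists_word (col := is_pos)) => //.
- exact: polygon_uniq.
- exact: polygon_alternating.
- by rewrite size_polygon.
rewrite -ncycles_pos // -ncycles_neg // mulgA deltaK mul1g total size_polygon.
by rewrite card_sum card_ord; lia.
Qed.

(** The powers of [gammat] connect all k > 0, and all k < 0; [s] connects the
    two halves because [p] has a pair inside one of them. *)
Lemma SNCdelta_transitive w p : cyclic_matching w p polygon ->
  [transitive <<[set (delta n * p)%g; gammat n]>>, on [set: pmset n] | 'P].
Proof.
move=> mw; pose G := <<[set (delta n * p)%g; gammat n]>>%G.
pose conn (x y : pmset n) := y \in orbit 'P G x.
have connT : transitive conn by move=> y x z xy yz; apply: orbit_trans yz xy.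
have connC x y : conn x y = conn y x by rewrite /conn orbit_sym.
have conns x : conn x ((delta n * p)%g x).
  by apply: (mem_orbit 'P x); rewrite mem_gen // !inE eqxx.
have conng x : conn x (gammat n x).
  by apply: (mem_orbit 'P x); rewrite mem_gen // !inE eqxx orbT.
have gpos i : gammat n (inl i) = inl (ordS i).
  rewrite /gammat !permM [delta n (inl i)]permE /=.
  have -> : (gamma n)^-1%g (inr i) = inr i by apply: (canLR (permK _)); rewrite permE.
  by rewrite !permE.
have gneg i : gammat n (inr (ordS i)) = inr i.
  rewrite /gammat !permM [delta n (inr _)]permE /=.
  have -> : (gamma n)^-1%g (inl (ordS i)) = inl i by apply: (canLR (permK _)); rewrite permE.
  by rewrite !permE.
have ord_succ (Q : 'I_n -> 'I_n -> Prop) : (forall i, Q i i) -> 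
    (forall i j k, Q i j -> Q j k -> Q i k) -> (forall i, Q i (ordS i)) -> forall i, Q ord0 i.
  move=> Q0 QT QS [k ltk]; elim: k ltk => [|k IH] ltk.
    by rewrite (_ : Ordinal ltk = ord0) //; apply: val_inj.
  apply: QT (IH (ltnW ltk)) _.
  rewrite (_ : Ordinal ltk = ordS (Ordinal (ltnW ltk))) //.
  by apply: val_inj; rewrite /= modn_small.
have pos i : conn (inl ord0) (inl i).
  apply: (ord_succ (fun i j => conn (inl i) (inl j))) => {}i; first exact: orbit_refl.
    by move=> j k; apply: connT.
  by rewrite -gpos; exact: conng.
have neg i : conn (inr ord0) (inr i).
  apply: (ord_succ (fun i j => conn (inr i) (inr j))) => {}i; first exact: orbit_refl.
    by move=> j k; apply: connT.
  by rewrite connC -[in X in conn _ X](gneg i); exact: conng.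
have [x _ cx] := cyclic_matching_same_color mw polygon_uniq polygon_alternating.
have sx : conn (delta n x) (p x).
  have := conns (delta n x).
  by rewrite permM -[delta n (delta n x)]permM deltaK perm1.
have link : conn (inl ord0) (inr ord0).
  move: sx cx; rewrite [delta n x]permE; case: x => i; case: (p _) => //= j sx _.
    by rewrite connC; apply: (connT _ _ _ (neg i)); apply: (connT _ _ _ sx); rewrite connC.
  by apply: (connT _ _ _ (pos i)); apply: (connT _ _ _ sx); rewrite connC.
apply/imsetP; exists (inl ord0); rewrite ?inE //; apply/esym/setP => -[] i; rewrite [RHS]inE.
  exact: pos.
exact: (connT _ _ _ link (neg i)).
Qed.

Lemma word_SNCdelta w p : cyclic_matching w p polygon ->
  (delta n * p)%g \in SNCdelta n.
Proof.
move=> mw; have mp := cyclic_matchingP polygon_uniq mw.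
have dp : (delta n * (delta n * p))%g = p by rewrite mulgA deltaK mul1g.
rewrite inE (SNCdelta_transitive mw) dp andTb; apply/andP; split; last exact/pairing_matching.
have [l [l0 szP E]] := cyclic_matching_count mw polygon_uniq polygon_alternating.
have := E true; have := E false.
rewrite -ncycles_pos // -ncycles_neg // card_sum card_ord.
rewrite size_polygon in szP.
have : count (predC w) polygon = count [pred x | ~~ w x & is_pos x != true] polygon
    + count [pred x | ~~ w x & is_pos x != false] polygon.
  by elim: polygon => //= x s ->; case: (w x); case: (is_pos x); rewrite /= ?add0n //; lia.
move: szP; move: (count _ _) (count _ _) (count _ _) (ncycles _) (ncycles _); clear.
by move=> *; apply/eqP; lia.
Qed.

Lemma cyclic_matching_ncycles w p : cyclic_matching w p polygon ->
  exists l, [/\ 0 < l, 2 * n = 4 * l + 2 * count (predC w) polygon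
    & ncycles (delta n * p)%g + 2 * l
        + 2 * count [pred x | ~~ w x & ~~ is_pos x] polygon = 2 * n].
Proof.
move=> mw; have mp := cyclic_matchingP polygon_uniq mw.
have [l [l0 szP E]] := cyclic_matching_count mw polygon_uniq polygon_alternating.
exists l; rewrite -size_polygon; split=> //; rewrite ncycles_pos // size_polygon.
have -> : 2 * n = #|pmset n| by rewrite card_sum card_ord mul2n addnn.
rewrite -(E true).
by congr (_ + 2 * _); apply: eq_count => x /=; case: (is_pos x).
Qed.

Lemma count_polygon (q : pred (pmset n)) :
  count q polygon = #|[set i | q (inl i)]| + #|[set i | q (inr i)]|.
Proof.
have -> : count q polygon = \sum_(x : pmset n | q x) 1.
  rewrite -sum1_count; apply: perm_big.
  apply: uniq_perm; rewrite ?polygon_uniq ?index_enum_uniq //.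
  by move=> x; rewrite mem_polygon mem_index_enum.
by rewrite big_sumType -!sum1dep_card.
Qed.

(** The first set collects the signs - and the second one the signs +, which
    makes the cardinals of both sets appear in the binomial coefficients. *)
Definition word (AB : {set 'I_n} * {set 'I_n}) (x : pmset n) : bool :=
  match x with inl i => i \notin AB.1 | inr i => i \in AB.2 end.

(** The excess of + over - in the word of (A, B) is twice |B| - |A|, so this is
    the condition that it be a positive multiple of 4. *)
Definition excess (a b : nat) := (a < b) && ~~ odd (b - a).

Lemma count_word AB :
  count (predC (word AB)) polygon = #|AB.1| + (n - #|AB.2|) /\
  count [pred x | ~~ word AB x & ~~ is_pos x] polygon = n - #|AB.2|.
Proof.
have cB : #|[set i | i \notin AB.2]| = n - #|AB.2|.
  rewrite (_ : [set i | _] = ~: AB.2); last by apply/setP => i; rewrite !inE.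
  by rewrite (cardsCs (~: _)) setCK card_ord.
rewrite !count_polygon /= -cB; split.
  by congr (_ + _); apply: eq_card => i; rewrite !inE ?negbK.
rewrite -[RHS]add0n; congr (_ + _); last by apply: eq_card => i; rewrite !inE andbT.
by apply/eqP; rewrite cards_eq0; apply/eqP/setP => i; rewrite !inE andbF.
Qed.

Lemma word_inj : forall AB AB', word AB =1 word AB' -> AB = AB'.
Proof.
move=> [A B] [A' B'] E; congr (_, _); apply/setP => i.
  by apply: negb_inj; apply: (E (inl i)).
exact: (E (inr i)).
Qed.

Lemma word_onto (w : pmset n -> bool) : exists AB, word AB =1 w.
Proof.
exists ([set i | ~~ w (inl i)], [set i | w (inr i)]) => -[i|i]; rewrite /= inE ?negbK //.
Qed.

Lemma word_excess (AB : {set 'I_n} * {set 'I_n}) p : cyclic_matching (word AB) p polygon ->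
  excess #|AB.1| #|AB.2| /\ ncycles (delta n * p)%g = #|AB.1| + #|AB.2|.
Proof.
have leB : #|AB.2| <= n by have := max_card [in AB.2]; rewrite card_ord.
move=> /cyclic_matching_ncycles[l []]; have [-> ->] := count_word AB.
rewrite /excess; move: leB; move: #|_| #|_| (ncycles _) => a b c; clear.
by move=> ? ? ? ?; split; lia.
Qed.

Lemma excess_matching (AB : {set 'I_n} * {set 'I_n}) : excess #|AB.1| #|AB.2| ->
  exists p, cyclic_matching (word AB) p polygon.
Proof.
have leB : #|AB.2| <= n by have := max_card [in AB.2]; rewrite card_ord.
have [E _] := count_word AB; rewrite /excess => ex.
have [||p _ mp] := exists_cyclic_matching (w := word AB) polygon_uniq; last by exists p.
  rewrite E size_polygon; move: leB ex; move: #|_| #|_| => a b; clear; lia.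
rewrite E size_polygon; move: leB ex; move: #|_| #|_| => a b; clear; lia.
Qed.

End Annulus.

Local Open Scope ring_scope.

(** * Sums *)

(** Change of variables in a double sum whose inner range depends on the outer
    index, along mutually inverse maps [f] and [g]. *)
Lemma sum_reindex (V : nmodType) (s1 s2 : seq nat) (t1 t2 : nat -> seq nat)
    (f g : nat -> nat -> nat * nat) (G : nat -> nat -> V) :
    uniq s1 -> uniq s2 -> (forall l, uniq (t1 l)) -> (forall k, uniq (t2 k)) ->
    (forall l j, l \in s1 -> j \in t1 l -> let: (k, i) := f l j in
       [/\ k \in s2, i \in t2 k & g k i = (l, j)]) ->
    (forall k i, k \in s2 -> i \in t2 k -> let: (l, j) := g k i in
       [/\ l \in s1, j \in t1 l & f l j = (k, i)]) ->
  \sum_(k <- s2) \sum_(i <- t2 k) G k i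
    = \sum_(l <- s1) \sum_(j <- t1 l) G (f l j).1 (f l j).2.
Proof.
move=> us1 us2 ut1 ut2 fP gP.
pose S (s : seq nat) (t : nat -> seq nat) := [seq (x, y) | x <- s, y <- t x].
have uS s t : uniq s -> (forall x, uniq (t x)) -> uniq (S s t).
  move=> us ut; apply: allpairs_uniq_dep => // -[x y] [x' y'] _ _ /= [-> ->] //.
pose f2 (x : nat * nat) := f x.1 x.2.
have inS s t x y : ((x, y) \in S s t) = (x \in s) && (y \in t x).
  apply/allpairsPdep/andP => [[x' [y' [xs yt [-> ->]]]] //|[xs yt]].
  by exists x, y.
transitivity (\sum_(z <- S s2 t2) G z.1 z.2); first by rewrite big_allpairs_dep.
transitivity (\sum_(z <- S s1 t1) G (f2 z).1 (f2 z).2); last by rewrite big_allpairs_dep.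
rewrite -(big_map f2 xpredT (fun z => G z.1 z.2)); apply: perm_big.
apply: uniq_perm; first exact: uS.
  rewrite map_inj_in_uniq ?uS // => -[l j] [l' j']; rewrite !inS => /andP[? ?] /andP[? ?].
  rewrite /f2 /= => E; have := fP l j; have := fP l' j'; rewrite E; case: (f l' j') => k i.
  by move=> [] // _ _ <- [] // _ _ <-.
move=> [k i]; rewrite inS; apply/andP/mapP => [[ks it]|[[l j]]].
  have := gP k i ks it; case E: (g k i) => [l j] [lS jS fE].
  by exists (l, j); rewrite ?inS ?lS // /f2 fE.
rewrite inS => /andP[ls jt]; rewrite /f2 /= => E.
by have := fP l j ls jt; rewrite -E => -[].
Qed.

Lemma sum_by_card (R : pzRingType) (n : nat) (G : nat -> R) :
  \sum_(A : {set 'I_n}) G #|A| = \sum_(0 <= k < n.+1) 'C(n, k)%:R * G k.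
Proof.
rewrite big_mkord (partition_big (fun A : {set 'I_n} => inord #|A| : 'I_n.+1) xpredT) //=.
apply: eq_bigr => k _.
have cE (A : {set 'I_n}) : (inord #|A| == k :> 'I_n.+1) = (#|A| == k).
  by rewrite -val_eqE /= inordK // ltnS -[X in (_ <= X)%N](card_ord n) max_card.
rewrite (eq_bigl _ _ cE) (eq_bigr (fun=> G k)) => [|A /eqP -> //].
rewrite sumr_const mulr_natl; congr (_ *+ _).
have := card_draws 'I_n k; rewrite card_ord => <-.
by apply: eq_card => A; rewrite !inE.
Qed.

(** The substitution is k = j + l, i = l. *)
Lemma sum_acoef (R : pzRingType) (n : nat) (c : R) :
  \sum_(1 <= l < (n %/ 2).+1) \sum_(0 <= j < (n - 2 * l).+1)
      'C(n, j)%:R * 'C(n, j + 2 * l)%:R * c ^+ (j + l)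
  = \sum_(1 <= k < n) (acoef n k)%:R * c ^+ k.
Proof.
transitivity (\sum_(1 <= k < n) \sum_(1 <= i < (minn k (n - k)).+1)
    'C(n, k - i)%:R * 'C(n, k + i)%:R * c ^+ k); last first.
  apply: eq_bigr => k _; rewrite /acoef natr_sum mulr_suml; apply: eq_bigr => i _.
  by rewrite natrM.
rewrite (@sum_reindex _ (index_iota 1 n) _ (fun k => index_iota 1 (minn k (n - k)).+1) _
  (fun k i => (i, k - i)%N) (fun l j => (j + l, l)%N)) => [|||||l j|k i]; last first.
- by rewrite !mem_index_iota => ? ?; split; [lia|lia|congr (_, _); lia].
- by rewrite !mem_index_iota => ? ?; split; [lia|lia|congr (_, _); lia].
- by move=> k; apply: iota_uniq.
- by move=> k; apply: iota_uniq.
- exact: iota_uniq.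
- exact: iota_uniq.
rewrite big_seq [RHS]big_seq; apply: eq_bigr => k; rewrite mem_index_iota => kn.
rewrite big_seq [RHS]big_seq; apply: eq_bigr => i; rewrite mem_index_iota => ik /=.
by congr (_ * 'C(_, _)%:R * _ ^+ _); lia.
Qed.

(** In the Vandermonde convolution for 2k, the terms at k - i and k + i agree;
    those with i > n - k vanish. *)
Lemma acoefE (n k : nat) : (1 <= k <= n - 1)%N ->
  (2 * acoef n k + 'C(n, k) * 'C(n, k) = 'C(2 * n, 2 * k))%N.
Proof.
move=> kn.
have acE : acoef n k = (\sum_(1 <= i < k.+1) 'C(n, k - i) * 'C(n, k + i))%N.
  rewrite /acoef (@big_cat_nat _ _ _ (minn k (n - k)).+1 1 k.+1) //=; last by lia.
  rewrite [X in (_ = _ + X)%N]big1_seq ?addn0 // => i; rewrite mem_index_iota => ik.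
  by rewrite [X in (_ * X)%N]bin_small ?muln0 //; lia.
rewrite [in RHS](_ : (2 * n = n + n)%N); last by lia.
rewrite -binomial.Vandermonde.
rewrite -(big_mkord xpredT (fun j => 'C(n, j) * 'C(n, 2 * k - j))%N).
rewrite (@big_cat_nat _ _ _ k 0 _) //=; last by lia.
rewrite (@big_ltn _ _ _ k) /=; last by lia.
have -> : (\sum_(0 <= j < k) 'C(n, j) * 'C(n, 2 * k - j) = acoef n k)%N.
  rewrite acE big_nat_rev /= big_add1 /= !big_mkord; apply: eq_bigr => i _.
  by congr ('C(_, _) * 'C(_, _))%N; have := ltn_ord i; lia.
have -> : (\sum_(k.+1 <= j < (2 * k).+1) 'C(n, j) * 'C(n, 2 * k - j) = acoef n k)%N.
  rewrite acE -{1}[k.+1]add1n big_addn !big_nat.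
  rewrite (_ : ((2 * k).+1 - k = k.+1)%N); last by lia.
  by apply: eq_bigr => i ik; rewrite mulnC; congr ('C(_, _) * 'C(_, _))%N; lia.
by rewrite (_ : (2 * k - k = k)%N); lia.
Qed.

Local Notation setpair n := ({set 'I_n} * {set 'I_n})%type.

(** The bijection between words and admissible permutations: [h] chooses a
    matching for a pair of sets and [h'] a pair of sets for a permutation;
    they are mutually inverse because word and matching determine each other. *)
Lemma sum_SNCdelta (V : nmodType) (m : nat) (F : nat -> V) :
  \sum_(s in SNCdelta m.+1) F (ncycles s)
    = \sum_(AB : {set 'I_m.+1} * {set 'I_m.+1} | excess #|AB.1| #|AB.2|)
        F (#|AB.1| + #|AB.2|)%N.
Proof.
pose d := delta m.+1.
pose code (AB : setpair m.+1) (p : {perm pmset m.+1}) :=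
  `[< cyclic_matching (word AB) p (polygon m) >].
pose h (AB : setpair m.+1) := (d * odflt 1 [pick p | code AB p])%g.
pose h' s : setpair m.+1 := odflt (finset.set0, finset.set0) [pick AB | code AB (d * s)%g].
have uL := polygon_uniq m.
have dK s : (d * (d * s))%g = s by rewrite mulgA deltaK mul1g.
have h'P s : s \in SNCdelta m.+1 -> code (h' s) (d * s)%g.
  move=> /SNCdelta_word[w mw]; have [AB eAB] := word_onto w.
  rewrite /h'; case: pickP => [//|/(_ AB)/asboolP[]].
  by apply: eq_cyclic_matching mw => // x _; rewrite eAB.
have hP (AB : setpair m.+1) : excess #|AB.1| #|AB.2| -> code AB (d * h AB)%g.
  move=> /excess_matching[p mp]; rewrite dK.
  by case: pickP => [//|/(_ p)/asboolP[]].
have code_perm AB p p' : code AB p -> code AB p' -> p = p'.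
  move=> /asboolP m1 /asboolP m2; apply/permP => x.
  by apply: cyclic_matching_inj_perm uL m1 m2 _ _; apply: mem_polygon.
have code_word AB AB' p : code AB p -> code AB' p -> AB = AB'.
  move=> /asboolP m1 /asboolP m2; apply: word_inj => x.
  by apply: cyclic_matching_inj_word uL m1 m2 _ _; apply: mem_polygon.
have codeE (AB : setpair m.+1) s : code AB (d * s)%g ->
    excess #|AB.1| #|AB.2| /\ ncycles s = (#|AB.1| + #|AB.2|)%N.
  by move=> /asboolP/word_excess; rewrite dK.
rewrite (reindex_onto h h'); last first.
  move=> s /h'P c; have [/hP ch _] := codeE _ _ c.
  by apply: (mulgI d); apply: code_perm ch c.
apply: eq_big => AB.
  apply/andP/idP => [[/h'P + /eqP E]|ex].
    by rewrite E => /codeE[].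
  have c := hP AB ex.
  have hS : h AB \in SNCdelta m.+1.
    by move/asboolP: c => /word_SNCdelta; rewrite dK.
  by split=> //; apply/eqP; apply: code_word (h'P _ hS) c.
move=> /andP[/h'P + /eqP E]; rewrite E => /codeE[_ ->] //.
Qed.

Theorem proposition19 (R : realType) (n : nat) (c : R) (hn : (1 <= n)%N)
    (hc : 0 < c) :
  [/\ \sum_(s in SNCdelta n) c `^ ((ncycles s)%:R / 2%:R)
        = \sum_(1 <= l < (n %/ 2).+1) \sum_(0 <= j < (n - 2 * l).+1)
            'C(n, j)%:R * 'C(n, j + 2 * l)%:R * c ^+ (j + l),
      \sum_(1 <= l < (n %/ 2).+1) \sum_(0 <= j < (n - 2 * l).+1)
            'C(n, j)%:R * 'C(n, j + 2 * l)%:R * c ^+ (j + l)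
        = \sum_(1 <= k < n) (acoef n k)%:R * c ^+ k
    & forall k : nat, (1 <= k <= n - 1)%N ->
        (acoef n k)%:R
          = 1 / 2%:R * ('C(2 * n, 2 * k)%:R - 'C(n, k)%:R * 'C(n, k)%:R) :> R].
Proof.
split; [|exact: sum_acoef|]; last first.
  move=> k /acoefE <-; rewrite natrD !natrM addrK mulrA div1r mulVf ?mul1r //.
case: n hn => // m _; set n := m.+1.
rewrite (sum_SNCdelta _ (fun k => c `^ (k%:R / 2%:R))).
pose G a b := if excess a b then c `^ ((a + b)%:R / 2%:R) else 0.
transitivity (\sum_(A : {set 'I_n}) \sum_(B : {set 'I_n}) G #|A| #|B|).
  by rewrite pair_big /= big_mkcond.
rewrite (sum_by_card _ (fun a => \sum_(B : {set 'I_n}) G a #|B|)).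
transitivity (\sum_(a <- index_iota 0 n.+1)
    \sum_(b <- [seq b <- index_iota 0 n.+1 | excess a b])
    'C(n, a)%:R * 'C(n, b)%:R * c `^ ((a + b)%:R / 2%:R)).
  apply: eq_bigr => a _; rewrite (sum_by_card _ (G a)) mulr_sumr big_filter [RHS]big_mkcond.
  by apply: eq_bigr => b _; rewrite /G; case: ifP; rewrite ?mulr0 ?mulrA.
rewrite (@sum_reindex _ (index_iota 1 (n %/ 2).+1) _ (fun l => index_iota 0 (n - 2 * l).+1) _
  (fun l j => (j, j + 2 * l)%N) (fun a b => ((b - a) %/ 2, a)%N)) => [|||||l j|a b]; last first.
- rewrite mem_filter !mem_index_iota /excess => ? ?; split; [lia|lia|congr (_, _); lia].
- rewrite mem_filter !mem_index_iota /excess => ? ?; split; [lia|lia|congr (_, _); lia].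
- by move=> k; rewrite filter_uniq ?iota_uniq.
- by move=> k; apply: iota_uniq.
- exact: iota_uniq.
- exact: iota_uniq.
apply: eq_bigr => l _; apply: eq_bigr => j _ /=; congr (_ * _).
rewrite (_ : (j + (j + 2 * l) = (j + l) * 2)%N); last by lia.
by rewrite natrM mulfK ?pnatr_eq0 // powR_mulrn // ltW.
Qed.
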